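(* Let $\varphi_0,\varphi_1\in L^\infty(\mathbb{T})$ and let $\Phi=\begin{pmatrix}\varphi_0&\varphi_1\\ \varphi_1&\varphi_0\end{pmatrix}$. Then the block Toeplitz operator $T_\Phi$ on $H^2(\mathbb{C}^2)$ has a non-trivial closed reducing subspace.
   Context: $\mathbb{T}$ is the unit circle. $H^2(\mathbb{C}^2)$ is the $\mathbb{C}^2$-valued Hardy space, $P$ the orthogonal projection of $L^2(\mathbb{T};\mathbb{C}^2)$ onto it, and $T_\Phi f=P(\Phi f)$ for $f\in H^2(\mathbb{C}^2)$. A closed subspace $\mathcal{M}$ is reducing for $T$ if both $\mathcal{M}$ and $\mathcal{M}^\perp$ are invariant under $T$; non-trivial means neither $\{0\}$ nor the whole space. *)

(* Defs.v *)
From HB Require Import structures.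
From mathcomp Require Import all_boot all_order all_algebra.
From mathcomp Require Import all_classical all_reals all_analysis.
From mathcomp Require Import measurable_realfun complex.

Set Implicit Arguments.
Unset Strict Implicit.
Unset Printing Implicit Defensive.
Import Order.TTheory GRing.Theory Num.Theory.
Import numFieldNormedType.Exports.

Local Open Scope classical_set_scope.
Local Open Scope ring_scope.
Local Open Scope complex_scope.

Definition circle (R : realType) : Type := {z : R[i] | Normc.normc z == 1}.

Definition circle_val (R : realType) (z : circle R) : R[i] := sval z.

Definition circle_coord (R : realType) (z : circle R) : R * R :=
  (complex.Re (circle_val z), complex.Im (circle_val z)).

HB.instance Definition _ (R : realType) := Choice.on (circle R).
(* the base point 1 is only there because measurable types are pointed *)
HB.instance Definition _ (R : realType) :=
  isPointed.Build (circle R) (exist (fun z : R[i] => Normc.normc z == 1) 1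
    (introT eqP (@Normc.normc1 R))).

(* Borel sigma-algebra of the circle: trace of the Borel sets of R * R *)
HB.instance Definition _ (R : realType) :=
  Measurable.copy (circle R) (g_sigma_algebra_preimageType (@circle_coord R)).

Lemma normc_expi (R : realType) (t : R) :
  Normc.normc (cos (2 * pi * t) +i* sin (2 * pi * t)) == 1.
Proof. by rewrite /Normc.normc cos2Dsin2 sqrtr1. Qed.

(* t |-> exp(2 pi i t) *)
Definition expi (R : realType) (t : measurableTypeR R) : circle R :=
  exist (fun z : R[i] => Normc.normc z == 1) _ (normc_expi t).

Lemma measurable_expi (R : realType) : measurable_fun setT (@expi R).
Proof.
move=> _ _ [B mB <-]; rewrite !setTI.
have h : measurable_fun (setT : set (measurableTypeR R))
    (fun t : measurableTypeR R => (cos (2 * pi * t), sin (2 * pi * t)) : R * R).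
  have lin : continuous (fun t : R => 2 * pi * t) by exact: mulrl_continuous.
  apply/measurable_fun_pairP; split; apply: continuous_measurable_fun => t /=.
    by apply: (continuous_comp (lin t)); exact: continuous_cos.
  by apply: (continuous_comp (lin t)); exact: continuous_sin.
by have := h measurableT B mB; rewrite setTI.
Qed.

HB.instance Definition _ (R : realType) :=
  isMeasurableFun.Build _ _ (measurableTypeR R) (circle R) (@expi R)
    (@measurable_expi R).

(* normalized arc length *)
Definition circle_measure (R : realType) : set (circle R) -> \bar R :=
  pushforward (mrestr (@lebesgue_measure R) (measurable_itv `[0%R, 1%R]))
    (@expi R).

Section circle_measure_is_measure.
Context (R : realType).
Local Notation m := (@circle_measure R).

Let m0 : m set0 = 0%E. Proof. exact: measure0. Qed.

Let m_ge0 A : (0 <= m A)%E. Proof. exact: measure_ge0. Qed.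

Let m_sigma_additive : semi_sigma_additive m.
Proof. exact: measure_semi_sigma_additive. Qed.

HB.instance Definition _ := isMeasure.Build _ _ _ m m0 m_ge0 m_sigma_additive.

Let mT : m setT = 1%E.
Proof.
rewrite /circle_measure /pushforward preimage_setT /mrestr setTI.
by rewrite lebesgue_measure_itv/= lte_fin ltr01 oppr0 adde0.
Qed.

HB.instance Definition _ := Measure_isProbability.Build _ _ _ m mT.

End circle_measure_is_measure.

(* R[i] carries no measurable structure in the library, so measurability and
   integrals of complex functions go through real and imaginary parts. *)
Definition cmeasurable (R : realType) (f : circle R -> R[i]) : Prop :=
  measurable_fun setT (fun z => complex.Re (f z)) /\
  measurable_fun setT (fun z => complex.Im (f z)).

Definition cintegral (R : realType) (f : circle R -> R[i]) : R[i] :=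
  (\int[@circle_measure R]_z complex.Re (f z))
    +i* (\int[@circle_measure R]_z complex.Im (f z)).

Definition Linfty (R : realType) : set (circle R -> R[i]) :=
  [set phi : circle R -> R[i] | cmeasurable phi /\
     finite_norm (@circle_measure R) +oo%E (fun z => Normc.normc (phi z))].

(* Elements of L^2(T; C^n) are handled through representatives, equality in L^2
   being equality almost everywhere. *)
Definition vfun (R : realType) (n : nat) := circle R -> 'cV[R[i]]_n.

Definition vnorm (R : realType) (n : nat) (v : 'cV[R[i]]_n) : R :=
  Num.sqrt (\sum_(i < n) Normc.normc (v i 0) ^+ 2).

Definition L2norm (R : realType) (n : nat) (f : vfun R n) : \bar R :=
  'N[@circle_measure R]_2 [EFin \o (fun z => vnorm (f z))]%E.

Definition L2 (R : realType) (n : nat) : set (vfun R n) :=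
  [set f : vfun R n | (forall i, cmeasurable (fun z => f z i 0)) /\
           (L2norm f < +oo)%E].

Definition L2inner (R : realType) (n : nat) (f g : vfun R n) : R[i] :=
  cintegral (fun z => \sum_(i < n) f z i 0 * (g z i 0)^*).

(* k-th Fourier coefficient of the i-th component *)
Definition fourier (R : realType) (n : nat) (f : vfun R n) (i : 'I_n)
    (k : int) : R[i] :=
  cintegral (fun z => f z i 0 * circle_val z ^ (- k)).

(* the Hardy space H^2(C^n), as a subspace of L^2(T; C^n) *)
Definition H2 (R : realType) (n : nat) : set (vfun R n) :=
  [set f : vfun R n | L2 f /\ forall i (k : int), k < 0 -> fourier f i k = 0].

(* Orthogonal projection of L^2(T; C^n) onto H^2(C^n): [hardy_proj f] is the
   element g of H^2 (unique up to a null set; the default 0 is not reached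
   for f in L^2) such that f - g is orthogonal to H^2. *)
Definition hardy_proj (R : realType) (n : nat) (f : vfun R n) : vfun R n :=
  xget (fun=> 0)
    [set g : vfun R n | H2 g /\ forall h, H2 h -> L2inner (fun z => f z - g z) h = 0].

Definition toeplitz (R : realType) (n : nat) (Phi : circle R -> 'M[R[i]]_n)
    (f : vfun R n) : vfun R n :=
  hardy_proj (fun z => Phi z *m f z).

Definition subspace_of_H2 (R : realType) (n : nat) (M : set (vfun R n)) :=
  [/\ M `<=` @H2 R n, M (fun=> 0) &
      forall (a : R[i]) (f g : vfun R n),
        M f -> M g -> M (fun z => a *: f z + g z)].

(* Closedness for the L^2 norm. It forces M to be saturated for equality almost
   everywhere, so that the sets M below are exactly the closed subspaces of the
   Hilbert space of classes. *)
Definition closed_in_H2 (R : realType) (n : nat) (M : set (vfun R n)) :=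
  forall f : vfun R n, H2 f ->
    (forall e : R, 0 < e ->
       exists2 g, M g & (L2norm (fun z => f z - g z)%R < e%:E)%E) ->
    M f.

Definition orth_in_H2 (R : realType) (n : nat) (M : set (vfun R n)) :
    set (vfun R n) :=
  [set f : vfun R n | H2 f /\ forall g, M g -> L2inner f g = 0].

Definition invariant_under (R : realType) (n : nat)
    (T : vfun R n -> vfun R n) (M : set (vfun R n)) :=
  forall f, M f -> M (T f).

Definition closed_reducing (R : realType) (n : nat)
    (T : vfun R n -> vfun R n) (M : set (vfun R n)) :=
  [/\ subspace_of_H2 M, closed_in_H2 M, invariant_under T M &
      invariant_under T (orth_in_H2 M)].

Definition zero_in_H2 (R : realType) (n : nat) : set (vfun R n) :=
  [set f : vfun R n | H2 f /\ f = (fun=> 0) %[ae @circle_measure R]].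

Definition nontrivial (R : realType) (n : nat) (M : set (vfun R n)) :=
  M <> @zero_in_H2 R n /\ M <> @H2 R n.

(* Main.v *)
Require Import Defs.
From HB Require Import structures.
From mathcomp Require Import all_boot all_order all_algebra.
From mathcomp Require Import all_classical all_reals all_analysis.
From mathcomp Require Import measurable_realfun complex ring.

Set Implicit Arguments.
Unset Strict Implicit.
Unset Printing Implicit Defensive.
Import Order.TTheory GRing.Theory Num.Theory.
Import numFieldNormedType.Exports.

Local Open Scope classical_set_scope.
Local Open Scope ring_scope.
Local Open Scope complex_scope.

(** Write S for the swap (f_0, f_1) |-> (f_1, f_0) of H^2(C^2).  The matrix
    Phi commutes with the constant matrix of S, so T_Phi commutes with S, and
    S is a self-adjoint unitary.  Its two eigenspaces
      E_+ = {f | f_1 = f_0 a.e.}   and   E_- = {f | f_1 = - f_0 a.e.}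
    are therefore orthogonal complements of each other and both invariant under
    T_Phi; thus E_+ is reducing.  It contains (1, 1) and misses (1, 0), hence
    it is non-trivial.

    Everything rests on one test-function argument.  To show that a function u
    of the scalar Hardy space vanishes a.e., exhibit an h in H^2(C^2) such that
    some inner product known to be 0 equals the integral of |u|^2
    ([cintegral_sqr_eq0]).
    - If f is orthogonal to E_s with s = 1 or s = -1, take u = f_1 + s f_0 and
      h = (s u, u): this gives [orth_swap_eigen].
    - If f is in E_s and g = T_Phi f, then Phi f - g is orthogonal to H^2(C^2);
      take u = g_1 - s g_0 and h = (s u, - u).  As Phi f is again
      s-symmetric, it disappears from the inner product and only |u|^2 remains:
      this gives [toeplitz_swap_eigen].
    The second argument is the uniqueness of the orthogonal projection of a
    swap-symmetric function.

    Vector-valued statements are reduced to scalar ones by [L2P] and [H2P].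
    That the constants lie in the Hardy space is the vanishing of the integral
    of z^n over the circle for n > 0 ([cintegral_circle_exp]), obtained from the
    fundamental theorem of calculus on [0, 1]. *)

(** * Real and imaginary parts *)

Section ComplexParts.
Context {R : rcfType}.
Implicit Types x y : R[i].

Lemma Re_add x y : complex.Re (x + y) = complex.Re x + complex.Re y.
Proof. by case: x y => [a b] [c d]. Qed.

Lemma Im_add x y : complex.Im (x + y) = complex.Im x + complex.Im y.
Proof. by case: x y => [a b] [c d]. Qed.

Lemma Re_mul x y : complex.Re (x * y) =
  complex.Re x * complex.Re y - complex.Im x * complex.Im y.
Proof. by case: x y => [a b] [c d]. Qed.

Lemma Im_mul x y : complex.Im (x * y) =
  complex.Re x * complex.Im y + complex.Im x * complex.Re y.
Proof. by case: x y => [a b] [c d] /=; rewrite [b * c]mulrC. Qed.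

Lemma Re_conj x : complex.Re (conjc x) = complex.Re x.
Proof. by case: x. Qed.

Lemma Im_conj x : complex.Im (conjc x) = - complex.Im x.
Proof. by case: x. Qed.

Lemma mul_conjc x :
  x * conjc x = (complex.Re x ^+ 2 + complex.Im x ^+ 2) +i* 0.
Proof.
case: x => a b; apply/eqP; rewrite eq_complex/=.
by rewrite mulrN opprK -!expr2 eqxx/= mulrN [b * a]mulrC addNr eqxx.
Qed.

Lemma sqr_normc x :
  Normc.normc x ^+ 2 = complex.Re x ^+ 2 + complex.Im x ^+ 2.
Proof. by case: x => a b /=; rewrite sqr_sqrtr// addr_ge0 ?sqr_ge0. Qed.

Lemma normc_ge0 x : 0 <= Normc.normc x.
Proof. by case: x => a b; exact: sqrtr_ge0. Qed.

Lemma norm_Re_le x : `|complex.Re x| <= Normc.normc x.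
Proof.
rewrite -(@ler_pXn2r _ 2)// ?nnegrE ?normc_ge0//.
by rewrite sqr_normc real_normK ?num_real// lerDl sqr_ge0.
Qed.

Lemma norm_Im_le x : `|complex.Im x| <= Normc.normc x.
Proof.
rewrite -(@ler_pXn2r _ 2)// ?nnegrE ?normc_ge0//.
by rewrite sqr_normc real_normK ?num_real// lerDr sqr_ge0.
Qed.

Lemma normc_le_parts x :
  Normc.normc x <= `|complex.Re x| + `|complex.Im x|.
Proof.
rewrite -(@ler_pXn2r _ 2)// ?nnegrE ?normc_ge0 ?addr_ge0//.
rewrite sqr_normc sqrrD !real_normK ?num_real//.
by rewrite -addrA lerD2l lerDr mulrn_wge0// mulr_ge0.
Qed.

Lemma normcD x y : Normc.normc (x + y) <= Normc.normc x + Normc.normc y.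
Proof. by rewrite -lecR rmorphD; exact: (ler_normD x y). Qed.

Lemma normc_sign (b : bool) x : Normc.normc ((-1) ^+ b * x) = Normc.normc x.
Proof.
by case: b; case: x => c d; rewrite ?mulN1r ?mul1r//= !sqrrN.
Qed.

End ComplexParts.

(** * Complex functions with p-integrable parts *)

Section LpFunctions.
Context {R : realType}.
Local Notation mu := (@circle_measure R).
Implicit Types (u v : circle R -> R[i]) (g h : circle R -> R).

Lemma cmeasurable_cst (c : R[i]) : cmeasurable (fun _ : circle R => c).
Proof. by split; exact: measurable_cst. Qed.

Lemma cmeasurableD u v : cmeasurable u -> cmeasurable v ->
  cmeasurable (fun z => u z + v z).
Proof.
move=> [ru iu] [rv iv]; split.
  by under eq_fun do rewrite Re_add; exact: measurable_funD.
by under eq_fun do rewrite Im_add; exact: measurable_funD.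
Qed.

Lemma cmeasurableM u v : cmeasurable u -> cmeasurable v ->
  cmeasurable (fun z => u z * v z).
Proof.
move=> [ru iu] [rv iv]; split.
  by under eq_fun do rewrite Re_mul;
    apply: measurable_funB; exact: measurable_funM.
by under eq_fun do rewrite Im_mul;
  apply: measurable_funD; exact: measurable_funM.
Qed.

Lemma cmeasurable_conj u : cmeasurable u -> cmeasurable (fun z => conjc (u z)).
Proof.
move=> [ru iu]; split; first by under eq_fun do rewrite Re_conj.
by under eq_fun do rewrite Im_conj; exact: measurableT_comp.
Qed.

Lemma measurable_normc u : cmeasurable u ->
  measurable_fun setT (fun z => Normc.normc (u z)).
Proof.
move=> [ru iu]; under eq_fun => z.
  rewrite (_ : Normc.normc _ =
      Num.sqrt (complex.Re (u z) ^+ 2 + complex.Im (u z) ^+ 2)); last first.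
    by case: (u z).
  over.
apply: (measurableT_comp (continuous_measurable_fun (@sqrt_continuous R))).
by apply: measurable_funD; exact: measurable_funX.
Qed.

Lemma measurable_vnorm n (f : vfun R n) :
  (forall i, cmeasurable (fun z => f z i 0)) ->
  measurable_fun setT (fun z => vnorm (f z)).
Proof.
move=> mf; apply: (measurableT_comp
  (continuous_measurable_fun (@sqrt_continuous R))).
by apply: measurable_sum => i; apply: measurable_funX; exact: measurable_normc.
Qed.

Lemma le_Lnorm2 g h : measurable_fun setT g -> measurable_fun setT h ->
  {ae mu, forall z, `|g z| <= `|h z|} ->
  ('N[mu]_2%:E[EFin \o g] <= 'N[mu]_2%:E[EFin \o h])%E.
Proof.
move=> mg mh gh; rewrite unlock gt0_ler_poweR//.
- by rewrite in_itv/= leey integral_ge0// => z _; exact: poweR_ge0.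
- by rewrite in_itv/= leey integral_ge0// => z _; exact: poweR_ge0.
have m2 (k : circle R -> R) : measurable_fun setT k ->
    measurable_fun setT (fun z : circle R => `|(EFin \o k) z| `^ 2)%E.
  move=> mk; apply: (measurableT_comp (measurable_poweR _)) => //.
  by apply: measurableT_comp => //; exact/measurable_EFinP.
apply: ae_ge0_le_integral => //; [|exact: m2| |exact: m2|].
- by move=> z _; exact: poweR_ge0.
- by move=> z _; exact: poweR_ge0.
apply: filterS gh => z ghz _ /=.
by rewrite lee_fin ge0_ler_powR// nnegrE.
Qed.

(** The comparison through which square integrability passes between a complex
    function and its parts, and between a vector function and its components. *)
Lemma Lfun2_le g h : measurable_fun setT g -> h \in Lfun mu 2%:E ->
  (forall z, `|g z| <= `|h z|) -> g \in Lfun mu 2%:E.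
Proof.
move=> mg /andP[/[!inE]/= mh hf] gh.
apply/andP; split; rewrite inE//=.
apply: le_lt_trans hf; apply: le_Lnorm2 => //.
exact: aeW.
Qed.

Lemma Lfun_sub12 g : g \in Lfun mu 2%:E -> g \in Lfun mu 1.
Proof. by apply: Lfun_subset12; exact: fin_num_measure. Qed.

(** Complex L^p is taken through the parts because the real [Lfun] already
    carries Minkowski's and Hoelder's inequalities. *)
Definition cLfun (p : \bar R) u :=
  (fun z => complex.Re (u z)) \in Lfun mu p /\
  (fun z => complex.Im (u z)) \in Lfun mu p.

Lemma cLfun_cmeasurable p u : cLfun p u -> cmeasurable u.
Proof.
by move=> [/andP[/[!inE]/= ru _] /andP[/[!inE]/= iu _]].
Qed.

Lemma LfunD p g h : (1 <= p)%E -> g \in Lfun mu p -> h \in Lfun mu p ->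
  (fun z => g z + h z) \in Lfun mu p.
Proof. by move=> p1 gp hp; exact: (Lfun_addr_closed mu p1).2. Qed.

Lemma LfunN p g : (1 <= p)%E -> g \in Lfun mu p -> (fun z => - g z) \in Lfun mu p.
Proof. by move=> p1 gp; exact: Lfun_oppr_closed gp. Qed.

Lemma LfunZ p c g : (1 <= p)%E -> g \in Lfun mu p ->
  (fun z => c * g z) \in Lfun mu p.
Proof.
move=> p1 gp; have [c0 cl] := Lfun_submod_closed mu p1.
by have := cl c _ _ gp c0; rewrite addr0.
Qed.

Lemma Lfun_sum p n (g : 'I_n -> circle R -> R) : (1 <= p)%E ->
  (forall i, g i \in Lfun mu p) -> (fun z => \sum_(i < n) g i z) \in Lfun mu p.
Proof.
move=> p1; elim: n g => [|n IH] g Lg.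
  under eq_fun do rewrite big_ord0.
  exact: (Lfun_addr_closed mu p1).1.
by under eq_fun do rewrite big_ord_recr; apply: LfunD => //; exact: IH.
Qed.

Lemma cLfun_cst c : cLfun 2%:E (fun=> c).
Proof. by split; exact: Lfun_cst. Qed.

Lemma cLfunD p u v : (1 <= p)%E -> cLfun p u -> cLfun p v ->
  cLfun p (fun z => u z + v z).
Proof.
move=> p1 [ru iu] [rv iv]; split.
  by under eq_fun do rewrite Re_add; exact: LfunD.
by under eq_fun do rewrite Im_add; exact: LfunD.
Qed.

Lemma cLfunZ p c u : (1 <= p)%E -> cLfun p u -> cLfun p (fun z => c * u z).
Proof.
move=> p1 [ru iu]; split.
  under eq_fun do rewrite Re_mul.
  by apply: LfunD => //; [|apply: LfunN => //]; exact: LfunZ.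
by under eq_fun do rewrite Im_mul; apply: LfunD => //; exact: LfunZ.
Qed.

Lemma cLfun_conj p u : (1 <= p)%E -> cLfun p u -> cLfun p (fun z => conjc (u z)).
Proof.
move=> p1 [ru iu]; split; first by under eq_fun do rewrite Re_conj.
by under eq_fun do rewrite Im_conj; exact: LfunN.
Qed.

Lemma cLfun2M u v : cLfun 2%:E u -> cLfun 2%:E v ->
  cLfun 1 (fun z => u z * v z).
Proof.
move=> [ru iu] [rv iv]; split.
  under eq_fun do rewrite Re_mul.
  by apply: LfunD => //; [|apply: LfunN => //]; exact: Lfun2_mul_Lfun1.
by under eq_fun do rewrite Im_mul; apply: LfunD => //; exact: Lfun2_mul_Lfun1.
Qed.

Lemma cintegralD u v : cLfun 1 u -> cLfun 1 v ->
  cintegral (fun z => u z + v z) = cintegral u + cintegral v.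
Proof.
move=> [/Lfun1_integrable ru /Lfun1_integrable iu].
move=> [/Lfun1_integrable rv /Lfun1_integrable iv].
rewrite /cintegral.
under eq_Rintegral do rewrite Re_add.
under [X in _ +i* X]eq_Rintegral do rewrite Im_add.
by rewrite !RintegralD.
Qed.

Lemma cintegralZ c u : cLfun 1 u ->
  cintegral (fun z => c * u z) = c * cintegral u.
Proof.
move=> [ru iu].
have LI (g : circle R -> R) : g \in Lfun mu 1 -> mu.-integrable setT (EFin \o g).
  by move/Lfun1_integrable.
rewrite /cintegral.
under eq_Rintegral do rewrite Re_mul.
under [X in _ +i* X]eq_Rintegral do rewrite Im_mul.
rewrite RintegralB// ?RintegralD//; try by apply: LI; exact: LfunZ.
rewrite !RintegralZl//; try exact: LI.
by case: c.
Qed.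

Lemma cintegral0 : cintegral (fun _ : circle R => 0) = 0.
Proof. by rewrite /cintegral /= !Rintegral_cst// !mul0r. Qed.

Lemma cintegral_ae u v : cmeasurable u -> cmeasurable v ->
  {ae mu, forall z, u z = v z} -> cintegral u = cintegral v.
Proof.
move=> [ru iu] [rv iv] uv; rewrite /cintegral /Rintegral.
congr (fine _ +i* fine _); apply: ae_eq_integral => //;
  try exact/measurable_EFinP.
- by apply: filterS uv => z -> _.
- by apply: filterS uv => z -> _.
Qed.

(** Square integrability of u is essential: [cintegral] takes the value 0 when
    the integral of |u|^2 is infinite. *)
Lemma cintegral_sqr_eq0 u : cLfun 2%:E u ->
  cintegral (fun z => u z * conjc (u z)) = 0 -> {ae mu, forall z, u z = 0}.
Proof.
move=> Lu; have [ru iu] := Lu => -[+ _].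
have [/Lfun1_integrable uI _] := cLfun2M Lu (cLfun_conj (lee1n 2) Lu).
have E z : complex.Re (u z * conjc (u z)) =
    complex.Re (u z) ^+ 2 + complex.Im (u z) ^+ 2 by rewrite mul_conjc.
rewrite /Rintegral => I0.
have {}I0 : (\int[mu]_z (complex.Re (u z * conjc (u z)))%:E)%E = 0.
  by rewrite -(fineK (integrable_fin_num _ uI))// I0.
have mI : measurable_fun setT (fun z => (complex.Re (u z * conjc (u z)))%:E).
  exact: measurable_int uI.
have /(ae_eq_integral_abs mu measurableT mI) :
    (\int[mu]_z `|(complex.Re (u z * conjc (u z)))%:E|)%E = 0.
  rewrite -I0; apply: eq_integral => z _.
  by rewrite gee0_abs// lee_fin E addr_ge0 ?sqr_ge0.
apply: filterS => z /(_ I) /= [] /eqP.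
rewrite E paddr_eq0 ?sqr_ge0// !sqrf_eq0 => /andP[/eqP r0 /eqP i0].
by apply/eqP; rewrite eq_complex r0 i0 !eqxx.
Qed.

End LpFunctions.

(** * The characters z^k of the circle *)

Section Characters.
Context {R : realType}.
Local Notation mu := (@circle_measure R).

Lemma normc_circle (z : circle R) : Normc.normc (circle_val z) = 1.
Proof. exact/eqP/(svalP z). Qed.

Lemma normc_circle_exp (z : circle R) (k : int) :
  Normc.normc (circle_val z ^ k) = 1.
Proof.
have normX n : Normc.normc (circle_val z ^+ n) = 1.
  elim: n => [|n IH]; first exact: Normc.normc1.
  by rewrite exprS Normc.normcM normc_circle IH mulr1.
by case: k => n; rewrite ?NegzE -?exprnP -?exprnN ?Normc.normcV normX ?invr1.
Qed.

Lemma cmeasurable_circle_val : cmeasurable (@circle_val R).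
Proof.
have mcoord : measurable_fun setT (@circle_coord R).
  by move=> _ B mB; rewrite setTI; exists B => //; rewrite setTI.
split.
- exact: (measurableT_comp (@measurable_fst _ _ R R) mcoord).
- exact: (measurableT_comp (@measurable_snd _ _ R R) mcoord).
Qed.

Lemma circle_inv (z : circle R) : (circle_val z)^-1 = conjc (circle_val z).
Proof.
have z0 : circle_val z != 0.
  apply: contraTneq (oner_neq0 R) => z0.
  by rewrite -(normc_circle z) z0 Normc.normc0 eqxx.
apply: (mulfI z0); rewrite mulfV// mul_conjc -sqr_normc normc_circle.
by rewrite expr1n.
Qed.

Lemma cmeasurable_circle_exp (k : int) :
  cmeasurable (fun z : circle R => circle_val z ^ k).
Proof.
have mX (u : circle R -> R[i]) n : cmeasurable u ->
    cmeasurable (fun z => u z ^+ n).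
  move=> mes_u; elim: n => [|n IH]; first exact: cmeasurable_cst.
  by under eq_fun do rewrite exprS; exact: cmeasurableM.
case: k => n; first exact: mX cmeasurable_circle_val.
rewrite NegzE; under eq_fun do rewrite -exprnN -exprVn circle_inv.
apply: mX; apply: cmeasurable_conj; exact: cmeasurable_circle_val.
Qed.

Lemma cLfun_circle_exp (k : int) :
  cLfun 2%:E (fun z : circle R => circle_val z ^ k).
Proof.
have [mr mi] := cmeasurable_circle_exp k.
split; apply: (Lfun2_le _ (Lfun_cst _ 1 2)) => // z; rewrite normr1.
- by rewrite -(normc_circle_exp z k) norm_Re_le.
- by rewrite -(normc_circle_exp z k) norm_Im_le.
Qed.

(** De Moivre's formula. *)
Lemma expi_exp (t : R) n : circle_val (expi t) ^+ n =
  cos (2 * pi * n%:R * t) +i* sin (2 * pi * n%:R * t).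
Proof.
elim: n => [|n IH]; first by rewrite mulr0 mul0r cos0 sin0.
rewrite exprS IH /circle_val/=.
have -> : 2 * pi * n.+1%:R * t = 2 * pi * t + 2 * pi * n%:R * t.
  by rewrite -addn1 natrD; ring.
by rewrite cosD sinD; congr (_ +i* _); rewrite addrC.
Qed.

(** Transfer to [0, 1], where the fundamental theorem of calculus applies; the
    bound on g serves for integrability. *)
Lemma Rintegral_circle (g : circle R -> R) (M : R) : measurable_fun setT g ->
  (forall z, `|g z| <= M) ->
  \int[mu]_z g z = \int[lebesgue_measure]_(t in `[0%R, 1%R]) g (expi t).
Proof.
move=> mg gM; congr fine; set D := `[0%R, 1%R]%classic.
have mD : measurable D by exact: measurable_itv.
have mgexp : measurable_fun setT (g \o @expi R : measurableTypeR R -> R).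
  exact: measurableT_comp mg (@measurable_expi R).
pose nu := mrestr (@lebesgue_measure R) (measurable_itv `[0%R, 1%R]).
have nuT : (nu setT < +oo)%E.
  by rewrite /nu /mrestr setTI lebesgue_measure_itv/= lte_fin ltr01 -EFinD ltry.
have inu : nu.-integrable setT (EFin \o (g \o @expi R)).
  apply: measurable_bounded_integrable => //.
  exists M; split; first exact: num_real.
  by move=> x Mx y _ /=; exact: le_trans (gM _) (ltW Mx).
rewrite /circle_measure (integral_pushforward (@measurable_expi R))//;
  last exact/measurable_EFinP.
rewrite preimage_setT (@negligible_integral _ _ _ nu setT (~` D))//.
- rewrite setTD setCK; apply: eq_measure_integral => A mA AD.
  by rewrite /nu /mrestr; congr (lebesgue_measure _); apply/setIidPl.
- exact: measurableC.
- by rewrite -[LHS]/(@lebesgue_measure R (~` D `&` D)) setICl measure0.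
Qed.

Lemma Rintegral_derive_periodic (f F : R -> R) : continuous f ->
  (forall t : R, is_derive t 1 F (f t)) -> F 1 = F 0 ->
  \int[lebesgue_measure]_(t in `[0%R, 1%R]) f t = 0.
Proof.
move=> cf dF F10.
have cF : continuous F.
  move=> t; apply: differentiable_continuous; apply/derivable1_diffP.
  by have [] := dF t.
rewrite /Rintegral (@continuous_FTC2 _ f F)//.
- by rewrite F10 -EFinB subrr.
- exact: continuous_subspaceT.
- split; first by move=> t _; have [] := dF t.
  + exact/cvg_at_right_filter/cF.
  + exact/cvg_at_left_filter/cF.
- by move=> t _; rewrite derive1E; have [] := dF t.
Qed.

(** The parts of z^n are cos (a t) and sin (a t) with a = 2 pi n, and they have
    primitives of period 1. *)
Lemma cintegral_circle_exp n : (0 < n)%N ->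
  cintegral (fun z : circle R => circle_val z ^ n%:Z) = 0.
Proof.
move=> n0; pose a : R := 2 * pi * n%:R.
have a0 : a != 0 by rewrite !mulf_neq0 ?pnatr_eq0 -?lt0n// gt_eqF ?pi_gt0.
have [mr mi] := cmeasurable_circle_exp n.
have [ca sa] : cos a = 1 /\ sin a = 0.
  (* De Moivre at t = 1, where [expi] takes the value 1 *)
  have := expi_exp 1 n; rewrite mulr1 -/a /circle_val/= mulr1.
  by rewrite mulr_natl cos2pi sin2pi expr1n => -[-> ->].
have ct : continuous (fun t : R => a * t) by exact: mulrl_continuous.
rewrite /cintegral; congr (_ +i* _).
- rewrite (Rintegral_circle mr (M := 1)); last first.
    by move=> z; rewrite -(normc_circle_exp z n) norm_Re_le.
  transitivity (\int[lebesgue_measure]_(t in `[0%R, 1%R]) cos (a * t)).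
    by apply: eq_Rintegral => t _; rewrite -exprnP expi_exp.
  apply: (@Rintegral_derive_periodic _ (fun t => a^-1 * sin (a * t))).
  + move=> t; apply: (continuous_comp (ct t)); exact: continuous_cos.
  + move=> t; apply: is_derive_eq; rewrite /GRing.scale/=.
    by rewrite mulr1 [_ * a]mulrC mulKf.
  + by rewrite mulr1 mulr0 sa sin0.
- rewrite (Rintegral_circle mi (M := 1)); last first.
    by move=> z; rewrite -(normc_circle_exp z n) norm_Im_le.
  transitivity (\int[lebesgue_measure]_(t in `[0%R, 1%R]) sin (a * t)).
    by apply: eq_Rintegral => t _; rewrite -exprnP expi_exp.
  apply: (@Rintegral_derive_periodic _ (fun t => - a^-1 * cos (a * t))).
  + move=> t; apply: (continuous_comp (ct t)); exact: continuous_sin.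
  + move=> t; apply: is_derive_eq; rewrite /GRing.scale/=.
    by rewrite mulr1 mulNr mulNr mulrN opprK [_ * a]mulrC mulKf.
  + by rewrite mulr1 mulr0 ca cos0.
Qed.

End Characters.

(** * Componentwise description of L^2 and of the Hardy space *)

Section HardySpace.
Context {R : realType}.
Local Notation mu := (@circle_measure R).
Implicit Types (u v : circle R -> R[i]).

Definition hardy u := cLfun 2%:E u /\
  forall k : int, k < 0 -> cintegral (fun z => u z * circle_val z ^ (- k)) = 0.

Lemma norm_vnorm n (w : 'cV[R[i]]_n) : `|vnorm w| = vnorm w.
Proof. by rewrite ger0_norm// sqrtr_ge0. Qed.

Lemma normc_le_vnorm n (w : 'cV[R[i]]_n) i : Normc.normc (w i 0) <= vnorm w.
Proof.
rewrite -(@ger0_norm _ (Normc.normc _)) ?normc_ge0// -sqrtr_sqr.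
rewrite ler_sqrt ?sumr_ge0// => [|j _]; last exact: sqr_ge0.
by rewrite (bigD1 i)//= lerDl sumr_ge0// => j _; exact: sqr_ge0.
Qed.

Lemma vnorm_le_sum n (w : 'cV[R[i]]_n) :
  vnorm w <= \sum_(i < n) (`|complex.Re (w i 0)| + `|complex.Im (w i 0)|).
Proof.
have s0 : 0 <= \sum_(i < n) (`|complex.Re (w i 0)| + `|complex.Im (w i 0)|).
  by apply: sumr_ge0 => i _; exact: addr_ge0.
rewrite -(ger0_norm s0) -sqrtr_sqr ler_sqrt ?sqr_ge0//.
rewrite expr2 mulr_sumr; apply: ler_sum => i _.
rewrite expr2 ler_pM ?normc_ge0// (le_trans (normc_le_parts _))//.
by rewrite (bigD1 i)//= lerDl sumr_ge0// => j _; exact: addr_ge0.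
Qed.

(** |Re f_i| and |Im f_i| are at most the Euclidean norm of f, which is at most
    the sum of all of them. *)
Lemma L2P n (f : vfun R n) : L2 f <-> forall i, cLfun 2%:E (fun z => f z i 0).
Proof.
split=> [[mf nf] i|Lf].
- have Lv : (fun z => vnorm (f z)) \in Lfun mu 2%:E.
    by apply/andP; split; rewrite inE//=; exact: measurable_vnorm.
  have [mr mi] := mf i.
  split; apply: (Lfun2_le _ Lv) => // z; rewrite norm_vnorm.
  + exact: le_trans (norm_Re_le _) (normc_le_vnorm _ _).
  + exact: le_trans (norm_Im_le _) (normc_le_vnorm _ _).
- have mf i : cmeasurable (fun z => f z i 0) by exact: cLfun_cmeasurable (Lf i).
  split=> //.
  have LfunA (g : circle R -> R) : g \in Lfun mu 2%:E ->
      (fun z => `|g z|) \in Lfun mu 2%:E.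
    move=> Lg; apply: (Lfun2_le _ Lg) => [|z]; last by rewrite normr_id.
    by case/andP: Lg => /[!inE]/= mg _; exact: measurableT_comp.
  have Ls : (fun z => \sum_(i < n) (`|complex.Re (f z i 0)| +
      `|complex.Im (f z i 0)|)) \in Lfun mu 2%:E.
    apply: Lfun_sum => [|i]; first exact: lee1n.
    by apply: LfunD; first exact: lee1n; apply: LfunA; have [] := Lf i.
  have : (fun z => vnorm (f z)) \in Lfun mu 2%:E.
    apply: (Lfun2_le _ Ls); first exact: measurable_vnorm.
    by move=> z; rewrite norm_vnorm (le_trans (vnorm_le_sum _))// ler_norm.
  by case/andP => _; rewrite inE.
Qed.

Lemma H2P n (f : vfun R n) : H2 f <-> forall i, hardy (fun z => f z i 0).
Proof.
split=> [[/L2P Lf ff] i|hf]; first by split=> // k; exact: ff.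
split; first by apply/L2P => i; exact: (hf i).1.
by move=> i k k0; exact: (hf i).2.
Qed.

Lemma hardyD u v : hardy u -> hardy v -> hardy (fun z => u z + v z).
Proof.
move=> [Lu fu] [Lv fv]; split; first by apply: cLfunD => //; exact: lee1n.
move=> k k0; under [X in cintegral X]eq_fun do rewrite mulrDl.
rewrite cintegralD ?fu ?fv ?addr0//; apply: cLfun2M => //;
  exact: cLfun_circle_exp.
Qed.

Lemma hardyZ c u : hardy u -> hardy (fun z => c * u z).
Proof.
move=> [Lu fu]; split; first by apply: cLfunZ => //; exact: lee1n.
move=> k k0; under [X in cintegral X]eq_fun do rewrite -mulrA.
rewrite cintegralZ ?fu ?mulr0//; apply: cLfun2M => //;
  exact: cLfun_circle_exp.
Qed.

Lemma hardy_cst c : hardy (fun=> c).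
Proof.
split; first exact: cLfun_cst.
case=> [//|n] _; rewrite cintegralZ.
  by rewrite NegzE opprK cintegral_circle_exp ?mulr0.
have [r i] := @cLfun_circle_exp R (- Negz n).
by split; exact: Lfun_sub12.
Qed.

Definition col2 u v : vfun R 2 := fun z => \col_i (if i == 0 then u z else v z).

Lemma H2_col2 u v : hardy u -> hardy v -> H2 (col2 u v).
Proof.
move=> hu hv; apply/H2P => i.
by under eq_fun do rewrite mxE; case: (i == 0).
Qed.

End HardySpace.

(** * The eigenspaces of the swap *)

Section SwapEigenspaces.
Context {R : realType}.
Local Notation mu := (@circle_measure R).
Implicit Types (f g h : vfun R 2) (b : bool).

(** The eigenspace of the swap for the eigenvalue (-1)^b. *)
Definition swap_eigen b : set (vfun R 2) :=
  [set f | H2 f /\ {ae mu, forall z, f z 1 0 = (-1) ^+ b * f z 0 0}].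

(** Stated with [conjc], on which the parts of a complex number compute; the
    conjugation in [L2inner] is convertible to it. *)
Lemma L2inner2 f g : L2inner f g =
  cintegral (fun z => f z 0 0 * conjc (g z 0 0) + f z 1 0 * conjc (g z 1 0)).
Proof.
rewrite /L2inner; congr cintegral; apply/funext => z.
rewrite !big_ord_recl big_ord0 addr0.
by have -> : lift ord0 ord0 = 1 :> 'I_2 by exact/val_inj.
Qed.

Lemma conjc_sign b (x : R[i]) : conjc ((-1) ^+ b * x) = (-1) ^+ b * conjc x.
Proof. by case: b; case: x => x y; rewrite ?mulN1r ?mul1r. Qed.

Lemma sign_sign b (x : R[i]) : (-1) ^+ b * ((-1) ^+ b * x) = x.
Proof. by case: b; rewrite !(mulN1r, mul1r, opprK). Qed.

Lemma sign_negb b (x : R[i]) : (-1) ^+ (~~ b) * x = - ((-1) ^+ b * x).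
Proof. by case: b; rewrite !(mulN1r, mul1r, opprK). Qed.

(** Testing f against (s u, u), with s = (-1)^b and u = f_1 + s f_0, gives the
    integral of |u|^2.  Conversely, for g in the s-eigenspace and f in the other
    one, f_0 conj(g_0) and f_1 conj(g_1) cancel. *)
Lemma orth_swap_eigen b : orth_in_H2 (swap_eigen b) = swap_eigen (~~ b).
Proof.
apply/seteqP; split=> f [Hf ef]; split=> //.
- have /H2P hf := Hf.
  pose u z := f z 1 0 + (-1) ^+ b * f z 0 0.
  have hu : hardy u by apply: hardyD; [|apply: hardyZ]; exact: hf.
  have : {ae mu, forall z, u z = 0}.
    apply: cintegral_sqr_eq0; first exact: hu.1.
    rewrite -[RHS](ef (col2 (fun z => (-1) ^+ b * u z) u)).
      rewrite L2inner2; congr cintegral; apply/funext => z.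
      rewrite !mxE/= conjc_sign /u; ring.
    split; first by apply: H2_col2 => //; exact: hardyZ.
    by apply: aeW => z; rewrite !mxE/= sign_sign.
  apply: filterS => z /eqP; rewrite addr_eq0 => /eqP ->.
  by rewrite sign_negb.
- move=> g [/H2P hg eg]; have /H2P hf := Hf.
  rewrite L2inner2 -[RHS](@cintegral0 R); apply: cintegral_ae.
  + by apply: cmeasurableD; apply: cmeasurableM; try apply: cmeasurable_conj;
      first [exact: cLfun_cmeasurable (hf _).1
            |exact: cLfun_cmeasurable (hg _).1].
  + exact: cmeasurable_cst.
  + apply: filterS2 ef eg => z -> ->; rewrite conjc_sign.
    by case: b; rewrite /= ?expr1 ?expr0; ring.
Qed.

Lemma swap_eigen_subspace b : subspace_of_H2 (swap_eigen b).
Proof.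
split.
- by move=> f [].
- split; last by apply: aeW => z; rewrite !mxE mulr0.
  by apply/H2P => i; under eq_fun do rewrite mxE; exact: hardy_cst.
- move=> a f g [/H2P hf ef] [/H2P hg eg]; split.
    apply/H2P => i; under eq_fun do rewrite !mxE.
    by apply: hardyD => //; exact: hardyZ.
  apply: filterS2 ef eg => z fz gz.
  by rewrite !mxE fz gz; ring.
Qed.

(** The defect u = f_1 - s f_0 is linear in f and vanishes on the eigenspace, so
    replacing f by f - g with g in the eigenspace does not change it a.e.; and
    |u| / 2 is at most the Euclidean norm of f - g, which is arbitrarily small
    in L^2. *)
Lemma swap_eigen_closed b : closed_in_H2 (swap_eigen b).
Proof.
move=> f Hf cl; split=> //; have /H2P hf := Hf.
pose u z := f z 1 0 + (-1) ^+ (~~ b) * f z 0 0.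
have hu : hardy u by apply: hardyD; [|apply: hardyZ]; exact: hf.
have mes_u := cLfun_cmeasurable hu.1.
have mn : measurable_fun setT (fun z => 2^-1 * Normc.normc (u z)).
  by apply: measurable_funM => //; exact: measurable_normc.
have N0 : 'N[mu]_2%:E[EFin \o (fun z => (2^-1 * Normc.normc (u z))%R)]%E = 0.
  apply/eqP; rewrite eq_le Lnorm_ge0 andbT; apply/lee_addgt0Pr => e e0.
  rewrite add0e; have [g [Hg eg] fg] := cl e e0.
  have /H2P hg := Hg.
  apply: le_trans (ltW fg); apply: le_Lnorm2 => //.
    apply: measurable_vnorm => i; under eq_fun do rewrite !mxE -mulN1r.
    by apply: cmeasurableD; [|apply: cmeasurableM; [exact: cmeasurable_cst|]];
      first [exact: cLfun_cmeasurable (hf _).1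
            |exact: cLfun_cmeasurable (hg _).1].
  apply: filterS eg => z gz.
  rewrite norm_vnorm ger0_norm ?mulr_ge0 ?invr_ge0 ?normc_ge0//.
  rewrite ler_pdivrMl// -[2]/(1 + 1) mulrDl mul1r.
  have -> : u z = (f z - g z) 1 0 + (-1) ^+ (~~ b) * (f z - g z) 0 0.
    by rewrite !mxE gz /u sign_negb sign_negb; ring.
  apply: le_trans (normcD _ _) _; rewrite normc_sign.
  by apply: lerD; exact: normc_le_vnorm.
have mn' := (measurable_EFinP _ _).2 mn.
have := Lnorm_eq0_eq0 mn' _ N0; rewrite lte_fin ltr0n => /(_ isT).
apply: filterS => z /(_ I) [] /eqP; rewrite mulf_eq0 invr_eq0 pnatr_eq0/=.
move=> /eqP /Normc.eq0_normc /eqP; rewrite /u sign_negb subr_eq0.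
by move/eqP.
Qed.

Context (phi0 phi1 : circle R -> R[i]).
Context (mphi0 : cmeasurable phi0) (mphi1 : cmeasurable phi1).

Let Phi z : 'M[R[i]]_2 :=
  \matrix_(i < 2, j < 2) (if i == j then phi0 z else phi1 z).

Lemma Phi_mulE z (w : 'cV[R[i]]_2) :
  ((Phi z *m w) 0 0 = phi0 z * w 0 0 + phi1 z * w 1 0) *
  ((Phi z *m w) 1 0 = phi1 z * w 0 0 + phi0 z * w 1 0).
Proof.
have E : lift ord0 ord0 = 1 :> 'I_2 by exact/val_inj.
by split; rewrite mxE !big_ord_recl big_ord0 addr0 E !mxE.
Qed.

(** Let g = T_Phi f.  Testing Phi f - g, which is orthogonal to H^2, against
    (s u, - u) with u = g_1 - s g_0 leaves the integral of |u|^2. *)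
Lemma toeplitz_swap_eigen b : invariant_under (toeplitz Phi) (swap_eigen b).
Proof.
move=> f [/H2P hf ef]; rewrite /toeplitz /hardy_proj.
(* the default value 0 of the projection lies in every subspace *)
case: xgetP => [g _ [Hg orth]|_]; last by have [_ + _] := swap_eigen_subspace b.
split=> //; have /H2P hg := Hg.
pose s : R[i] := (-1) ^+ b.
pose u z := g z 1 0 + (-1) * (s * g z 0 0).
have hu : hardy u by apply: hardyD; [|do 2 apply: hardyZ]; exact: hg.
have : {ae mu, forall z, u z = 0}.
  apply: cintegral_sqr_eq0; first exact: hu.1.
  have Hh : H2 (col2 (fun z => s * u z) (fun z => (-1) * u z)).
    by apply: H2_col2; exact: hardyZ.
  have mf i : cmeasurable (fun z => f z i 0) by exact: cLfun_cmeasurable (hf i).1.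
  have mg i : cmeasurable (fun z => g z i 0) by exact: cLfun_cmeasurable (hg i).1.
  have mes_u : cmeasurable u by exact: cLfun_cmeasurable hu.1.
  have mN v : cmeasurable v -> cmeasurable (fun z => - v z).
    by move=> mv; under eq_fun do rewrite -mulN1r;
      apply: cmeasurableM => //; exact: cmeasurable_cst.
  have E0 z : (Phi z *m f z - g z) 0 0 =
      phi0 z * f z 0 0 + phi1 z * f z 1 0 + - g z 0 0.
    by rewrite mxE Phi_mulE mxE.
  have E1 z : (Phi z *m f z - g z) 1 0 =
      phi1 z * f z 0 0 + phi0 z * f z 1 0 + - g z 1 0.
    by rewrite mxE Phi_mulE mxE.
  have h0 z : col2 (fun z => s * u z) (fun z => (-1) * u z) z 0 0 = s * u z.
    by rewrite mxE.
  have h1 z : col2 (fun z => s * u z) (fun z => (-1) * u z) z 1 0 = (-1) * u z.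
    by rewrite mxE.
  rewrite -[RHS](orth _ Hh) L2inner2; apply: cintegral_ae.
  - by apply: cmeasurableM => //; exact: cmeasurable_conj.
  - under eq_fun do rewrite E0 E1 h0 h1.
    by apply: cmeasurableD; apply: cmeasurableM;
      do ?[exact: mf|exact: mg|exact: cmeasurable_cst|apply: mN
          |apply: cmeasurable_conj|apply: cmeasurableD|apply: cmeasurableM].
  - apply: filterS ef => z fz; rewrite E0 E1 h0 h1 fz.
    rewrite conjc_sign (conjc_sign true) /u /s.
    move: (conjc _) => c; case: (b); rewrite /= ?expr1 ?expr0; ring.
by apply: filterS => z; rewrite /u mulN1r => /eqP; rewrite subr_eq0 => /eqP.
Qed.

End SwapEigenspaces.

(** * Non-triviality and conclusion *)

Lemma ae_ex (R : realType) (P : circle R -> Prop) :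
  {ae @circle_measure R, forall z, P z} -> exists z, P z.
Proof.
case=> N [_ N0 PN]; apply: contrapT => nP.
have NT : N = setT.
  by apply/seteqP; split=> // z _; apply: PN => Pz; apply: nP; exists z.
rewrite NT in N0; have := probability_setT (@circle_measure R).
by rewrite [LHS]N0 => -[] /eqP; rewrite eq_sym oner_eq0.
Qed.

Theorem proposition3p14 (R : realType) (phi0 phi1 : circle R -> R[i])
    (Hphi0 : Linfty phi0) (Hphi1 : Linfty phi1) :
  exists M : set (vfun R 2),
    closed_reducing
      (toeplitz (fun z : circle R =>
         \matrix_(i < 2, j < 2) (if i == j then phi0 z else phi1 z))) M
    /\ nontrivial M.
Proof.
have [mphi0 _] := Hphi0; have [mphi1 _] := Hphi1.
exists (swap_eigen false); split; [split|split].
- exact: swap_eigen_subspace.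
- exact: swap_eigen_closed.
- exact: toeplitz_swap_eigen.
- by rewrite orth_swap_eigen; exact: toeplitz_swap_eigen.
- have h1 : @swap_eigen R false (col2 (fun=> 1) (fun=> 1)).
    split; first by apply: H2_col2; exact: hardy_cst.
    by apply: aeW => z; rewrite !mxE mul1r.
  move=> E; move: h1; rewrite E => -[_ /ae_ex[z /(_ I) /matrixP /(_ 0 0)]].
  by rewrite !mxE /= => /eqP; rewrite oner_eq0.
- have h2 : @H2 R 2 (col2 (fun=> 1) (fun=> 0)) by apply: H2_col2; exact: hardy_cst.
  move=> E; move: h2; rewrite -E => -[_ /ae_ex[z]].
  by rewrite !mxE /= mul1r => /esym/eqP; rewrite oner_eq0.
Qed.
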